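(* Let $(A,\{\cdot,\cdot,\cdot\})$ be a nonzero finite-dimensional real $3$-pre-Lie algebra with a nondegenerate symmetric invariant bilinear form $\mathcal B$. Then $\{J,E\}$ is a perfect complex product structure on the semidirect product $3$-Lie algebra $A^c\ltimes_{L^*}A^*$, where, for all $x\in A$, $\alpha\in A^*$, $$E(x+\alpha)=x-\alpha,\qquad J(x+\alpha)=-(\mathcal B^\sharp)^{-1}(\alpha)+\mathcal B^\sharp(x),$$ and $\mathcal B^\sharp:A\to A^*$ is given by $\langle\mathcal B^\sharp(x),y\rangle=\mathcal B(x,y)$.
   Context: A $3$-Lie algebra is a vector space with a trilinear skew-symmetric bracket satisfying $[x,y,[z,w,v]]=[[x,y,z],w,v]+[z,[x,y,w],v]+[z,w,[x,y,v]]$. A $3$-pre-Lie algebra is a vector space $A$ with a trilinear map $\{\cdot,\cdot,\cdot\}$ such that, with $[x,y,z]_C:=\{x,y,z\}+\{y,z,x\}+\{z,x,y\}$: (1) $\{x,y,z\}=-\{y,x,z\}$; (2) $\{x_1,x_2,\{x_3,x_4,x_5\}\}=\{[x_1,x_2,x_3]_C,x_4,x_5\}+\{x_3,[x_1,x_2,x_4]_C,x_5\}+\{x_3,x_4,\{x_1,x_2,x_5\}\}$; (3) $\{[x_1,x_2,x_3]_C,x_4,x_5\}=\{x_1,x_2,\{x_3,x_4,x_5\}\}+\{x_2,x_3,\{x_1,x_4,x_5\}\}+\{x_3,x_1,\{x_2,x_4,x_5\}\}$. $A^c=(A,[\cdot,\cdot,\cdot]_C)$ is the sub-adjacent $3$-Lie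 algebra. Put $L(x,y)z=\{x,y,z\}$ and $\langle L^*(x,y)\alpha,z\rangle=-\langle\alpha,L(x,y)z\rangle$. The $3$-Lie algebra $A^c\ltimes_{L^*}A^*$ is $A\oplus A^*$ with bracket $[x_1+\alpha_1,x_2+\alpha_2,x_3+\alpha_3]_{L^*}=[x_1,x_2,x_3]_C+L^*(x_1,x_2)\alpha_3+L^*(x_2,x_3)\alpha_1+L^*(x_3,x_1)\alpha_2$. A bilinear form $\mathcal B$ on $A$ is invariant if $\mathcal B(\{x,y,z\},w)=-\mathcal B(z,\{x,y,w\})$ for all $x,y,z,w\in A$. A perfect product structure on a $3$-Lie algebra is a linear map $E$ with $E^2=\mathrm{Id}$, $E\neq\pm\mathrm{Id}$, $E[x,y,z]=[Ex,Ey,Ez]$. A complex structure is a linear map $J$ with $J^2=-\mathrm{Id}$ and $J[x,y,z]=-[Jx,Jy,Jz]+[Jx,y,z]+[x,Jy,z]+[x,y,Jz]+J[Jx,Jy,z]+J[x,Jy,Jz]+J[Jx,y,Jz]$. A perfect complex product structure is a pair $\{J,E\}$ of a complex structure $J$ and a perfect product structure $E$ with $J\circ E=-E\circ J$. *)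

(* Defs.v *)
From HB Require Import structures.
From mathcomp Require Import all_boot all_algebra.
From mathcomp Require Import ring.

Set Implicit Arguments.
Unset Strict Implicit.
Unset Printing Implicit Defensive.

Import GRing.Theory VectorInternalTheory.
Local Open Scope ring_scope.

Definition trilinear (K : fieldType) (V : lmodType K) (f : V -> V -> V -> V) :=
  [/\ forall y z, linear (fun x => f x y z),
      forall x z, linear (fun y => f x y z)
    & forall x y, linear (fun z => f x y z)].

(* The two adjacent transpositions generate all permutations of the arguments. *)
Definition skew_symmetric3 (V : zmodType) (f : V -> V -> V -> V) :=
  (forall x y z, f x y z = - f y x z) /\ (forall x y z, f x y z = - f x z y).

Record lie3 (K : fieldType) (V : lmodType K) := Lie3 {
  lie3_br :> V -> V -> V -> V;
  lie3_trilinear : trilinear lie3_br;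
  lie3_skew : skew_symmetric3 lie3_br;
  lie3_fundamental : forall x y z w v,
    lie3_br x y (lie3_br z w v) =
      lie3_br (lie3_br x y z) w v + lie3_br z (lie3_br x y w) v
      + lie3_br z w (lie3_br x y v)
}.

Definition cyclic_sum3 (V : zmodType) (f : V -> V -> V -> V) x y z :=
  f x y z + f y z x + f z x y.

Record prelie3 (K : fieldType) (A : lmodType K) := PreLie3 {
  prelie3_op :> A -> A -> A -> A;
  prelie3_trilinear : trilinear prelie3_op;
  prelie3_skew : forall x y z, prelie3_op x y z = - prelie3_op y x z;
  prelie3_ax2 : forall x1 x2 x3 x4 x5,
    prelie3_op x1 x2 (prelie3_op x3 x4 x5) =
      prelie3_op (cyclic_sum3 prelie3_op x1 x2 x3) x4 x5
      + prelie3_op x3 (cyclic_sum3 prelie3_op x1 x2 x4) x5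
      + prelie3_op x3 x4 (prelie3_op x1 x2 x5);
  prelie3_ax3 : forall x1 x2 x3 x4 x5,
    prelie3_op (cyclic_sum3 prelie3_op x1 x2 x3) x4 x5 =
      prelie3_op x1 x2 (prelie3_op x3 x4 x5)
      + prelie3_op x2 x3 (prelie3_op x1 x4 x5)
      + prelie3_op x3 x1 (prelie3_op x2 x4 x5)
}.

Section Structures.
Variables (K : fieldType) (V : lmodType K) (g : lie3 V).

Definition perfect_product_structure (E : V -> V) :=
  [/\ linear E,
      forall x, E (E x) = x,
      ~ (forall x, E x = x),
      ~ (forall x, E x = - x)
    & forall x y z, E (g x y z) = g (E x) (E y) (E z)].

Definition complex_structure (J : V -> V) :=
  [/\ linear J,
      forall x, J (J x) = - x
    & forall x y z,
        J (g x y z) =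
          - g (J x) (J y) (J z) + g (J x) y z + g x (J y) z + g x y (J z)
          + J (g (J x) (J y) z) + J (g x (J y) (J z)) + J (g (J x) y (J z))].

Definition perfect_complex_product_structure (J E : V -> V) :=
  [/\ complex_structure J,
      perfect_product_structure E
    & forall x, J (E x) = - E (J x)].

End Structures.

Section TrilinearTheory.
Variables (K : fieldType) (V : lmodType K) (f : V -> V -> V -> V).
Hypothesis f_tri : trilinear f.

Lemma tri1D x x' y z : f (x + x') y z = f x y z + f x' y z.
Proof. by have [/(_ y z 1 x x')] := f_tri; rewrite !scale1r. Qed.
Lemma tri2D x y y' z : f x (y + y') z = f x y z + f x y' z.
Proof. by have [_ /(_ x z 1 y y')] := f_tri; rewrite !scale1r. Qed.
Lemma tri3D x y z z' : f x y (z + z') = f x y z + f x y z'.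
Proof. by have [_ _ /(_ x y 1 z z')] := f_tri; rewrite !scale1r. Qed.
Lemma tri1N x y z : f (- x) y z = - f x y z.
Proof.
have f0 : f 0 y z = 0 by apply: (addrI (f 0 y z)); rewrite -tri1D !addr0.
by apply/eqP; rewrite -addr_eq0 -tri1D addNr f0.
Qed.
Lemma tri2N x y z : f x (- y) z = - f x y z.
Proof.
have f0 : f x 0 z = 0 by apply: (addrI (f x 0 z)); rewrite -tri2D !addr0.
by apply/eqP; rewrite -addr_eq0 -tri2D addNr f0.
Qed.
Lemma tri3N x y z : f x y (- z) = - f x y z.
Proof.
have f0 : f x y 0 = 0 by apply: (addrI (f x y 0)); rewrite -tri3D !addr0.
by apply/eqP; rewrite -addr_eq0 -tri3D addNr f0.
Qed.

Lemma cyclic_sum3_trilinear : trilinear (cyclic_sum3 f).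
Proof.
have [l1 l2 l3] := f_tri.
by split=> u v a x y; rewrite /cyclic_sum3 l1 l2 l3 !scalerDr;
   do !rewrite -!addrA; congr (_ + _);
   rewrite addrCA; congr (_ + _); rewrite [RHS]addrCA; congr (_ + _);
   rewrite addrCA.
Qed.

End TrilinearTheory.

Lemma dual_separates (K : fieldType) (A : vectType K) (a b : A) :
  (forall f : {linear A -> K^o}, f a = f b :> K) -> a = b.
Proof.
move=> ab; apply: v2r_inj; apply/rowP=> i.
pose f (x : A) : K^o := v2r x 0 i.
have f_lin : linear f by move=> c x y; rewrite /f linearP !mxE.
pose mf := GRing.isLinear.Build K A K^o *:%R f f_lin.
pose F : {linear A -> K^o} := HB.pack f mf.
exact: (ab F).
Qed.

Ltac vring :=
  let f := fresh "f" in
  apply: dual_separates => f;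
  rewrite ?(linearD, linearN) /=; ring.

Section SubAdjacent.
Variables (K : fieldType) (A : vectType K) (p : prelie3 A).

Local Notation C := (cyclic_sum3 p).

Let tri := prelie3_trilinear p.
Let triE := (tri1D tri, tri2D tri, tri3D tri, tri1N tri, tri2N tri, tri3N tri).
Let skew := prelie3_skew p.
Let ax2 := prelie3_ax2 p.
Let ax3 := prelie3_ax3 p.

Lemma cyclic_sum3_skew : skew_symmetric3 C.
Proof.
by split=> x y z; rewrite /cyclic_sum3 (skew x y z) (skew y z x) (skew z x y);
  vring.
Qed.

Lemma cyclic_sum3_cycle x y z : C x y z = C y z x.
Proof. by rewrite /cyclic_sum3; vring. Qed.

Lemma subadjacent_fundamental x1 x2 x3 x4 x5 :
  C x1 x2 (C x3 x4 x5) =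
    C (C x1 x2 x3) x4 x5 + C x3 (C x1 x2 x4) x5 + C x3 x4 (C x1 x2 x5).
Proof.
have lhs : C x1 x2 (C x3 x4 x5) =
    p x1 x2 (p x3 x4 x5) + p x1 x2 (p x4 x5 x3) + p x1 x2 (p x5 x3 x4)
    - p (C x3 x4 x5) x2 x1 + p (C x3 x4 x5) x1 x2.
  by rewrite [C x1 _ _]/cyclic_sum3 (skew x2) {1}/cyclic_sum3 !triE.
have rhs a b c : p a b (C x1 x2 c) =
    p a b (p x1 x2 c) - p a b (p c x2 x1) + p a b (p c x1 x2).
  by rewrite /cyclic_sum3 (skew x2 c) !triE.
rewrite lhs (ax2 x1 x2 x3) (ax2 x1 x2 x4) (ax2 x1 x2 x5) !(ax3 x3 x4 x5).
rewrite [C (C _ _ _) x4 x5]/cyclic_sum3 [C x3 (C _ _ _) x5]/cyclic_sum3.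
rewrite [C x3 x4 (C _ _ _)]/cyclic_sum3 !rhs.
by vring.
Qed.

Definition subadjacent : lie3 A :=
  Lie3 (cyclic_sum3_trilinear tri) cyclic_sum3_skew subadjacent_fundamental.

#[local] Opaque cyclic_sum3.

Lemma prelie3_four_term x1 x2 x3 x4 x5 :
  p (C x1 x2 x3) x4 x5 =
    - (p x3 (C x1 x2 x4) x5 + p x1 (C x2 x3 x4) x5 + p x2 (C x3 x1 x4) x5).
Proof.
have e12 : p (C x1 x2 x3) x4 x5 =
    p x1 x2 (p x3 x4 x5) - p x3 x4 (p x1 x2 x5) - p x3 (C x1 x2 x4) x5.
  by rewrite ax2; vring.
have e2 : p x2 (C x3 x1 x4) x5 = p (C x3 x4 x1) x2 x5.
  rewrite (skew x2) (cyclic_sum3_skew.2 x3 x1 x4).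
  by rewrite (tri1N tri (C x3 x4 x1)) opprK.
have e34 : p x1 (C x2 x3 x4) x5 =
    p x3 x4 (p x1 x2 x5) - p x1 x2 (p x3 x4 x5) - p x2 (C x3 x1 x4) x5.
  by rewrite e2 (ax2 x3 x4) (cyclic_sum3_cycle x2 x3 x4); vring.
by rewrite e12 e34; vring.
Qed.

Lemma prelie3_ax3_rev x1 x2 x3 x4 x5 :
  p (C x1 x2 x3) x4 x5 =
    p x4 x1 (p x2 x3 x5) + p x4 x2 (p x3 x1 x5) + p x4 x3 (p x1 x2 x5).
Proof.
have e a b d : p x4 d (p a b x5) =
    - p a b (p d x4 x5) + p d (C a b x4) x5 + p (C a b d) x4 x5.
  by rewrite (skew x4 d) (ax2 a b d x4); vring.
rewrite !e -(cyclic_sum3_cycle x1 x2 x3) (cyclic_sum3_cycle x3 x1 x2).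
have := prelie3_four_term x1 x2 x3 x4 x5; have := ax3 x1 x2 x3 x4 x5.
move: (p (C x1 x2 x3) x4 x5) (p x1 x2 _) (p x2 x3 _) (p x3 x1 _).
move: (p x3 _ _) (p x1 _ _) (p x2 _ _) => b3 b1 b2 X a3 a1 a2 X3 X4.
have -> : - a1 + b1 + X + (- a2 + b2 + X) + (- a3 + b3 + X) =
    - (a3 + a1 + a2) + (b3 + b1 + b2) + (X + X + X) by vring.
have -> : b3 + b1 + b2 = - X by rewrite X4 opprK.
by rewrite -X3; vring.
Qed.

End SubAdjacent.

Section SemiDirect.
Variables (K : fieldType) (A : vectType K) (p : prelie3 A).

Local Notation dual := 'Hom(A, K^o).
Local Notation C := (cyclic_sum3 p).

(* L^*(x, y) alpha, that is z |-> - <alpha, {x, y, z}>. *)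
Definition dualL (x y : A) (alpha : dual) : dual :=
  linfun (fun z : A => - alpha (p x y z) : K^o).

Lemma dualLE x y alpha z : dualL x y alpha z = - alpha (p x y z).
Proof.
pose f (z : A) : K^o := - alpha (p x y z).
have f_lin : linear f.
  move=> c u v; have [_ _ l3] := prelie3_trilinear p.
  by rewrite /f l3 linearP opprD scalerN.
pose mf := GRing.isLinear.Build K A K^o *:%R f f_lin.
pose F : {linear A -> K^o} := HB.pack f mf.
exact: (lfunE F).
Qed.

Definition semidirect_br (u1 u2 u3 : A * dual) : A * dual :=
  (subadjacent p u1.1 u2.1 u3.1,
   dualL u1.1 u2.1 u3.2 + dualL u2.1 u3.1 u1.2 + dualL u3.1 u1.1 u2.2).

Let tri := prelie3_trilinear p.
Let skew := prelie3_skew p.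

Lemma semidirect_eq (u v : A * dual) :
  u.1 = v.1 -> (forall w, u.2 w = v.2 w :> K) -> u = v.
Proof.
by case: u v => [x a] [y b] /= -> ab; congr pair; apply/lfunP.
Qed.

Let lE := (add_lfunE, opp_lfunE, scale_lfunE, dualLE).

Lemma semidirect_trilinear : trilinear semidirect_br.
Proof.
have [C1 C2 C3] := cyclic_sum3_trilinear tri.
have [p1 p2 p3] := tri.
by split=> u v a x y; apply: semidirect_eq => [|w] /=;
  rewrite ?C1 ?C2 ?C3 // !lE /= ?p1 ?p2 ?p3 ?linearP /= ?lE /= /GRing.scale /=; ring.
Qed.

Lemma semidirect_skew : skew_symmetric3 semidirect_br.
Proof.
have [s1 s2] := cyclic_sum3_skew p.
split=> u v w; apply: semidirect_eq => [|z] /=.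
- exact: s1.
- rewrite !lE (skew u.1 v.1) (skew v.1 w.1) (skew w.1 u.1) !linearN /=.
  by ring.
- exact: s2.
- rewrite !lE (skew u.1 v.1) (skew v.1 w.1) (skew w.1 u.1) !linearN /=.
  by ring.
Qed.

Lemma semidirect_fundamental u1 u2 u3 u4 u5 :
  semidirect_br u1 u2 (semidirect_br u3 u4 u5) =
    semidirect_br (semidirect_br u1 u2 u3) u4 u5
    + semidirect_br u3 (semidirect_br u1 u2 u4) u5
    + semidirect_br u3 u4 (semidirect_br u1 u2 u5).
Proof.
apply: semidirect_eq => [|w] /=; first exact: subadjacent_fundamental.
move: u1 u2 u3 u4 u5 => [x1 a1] [x2 a2] [x3 a3] [x4 a4] [x5 a5] /=.
rewrite !lE (skew x2 (C x3 x4 x5)) !(prelie3_ax3_rev p x3 x4 x5).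
have := (prelie3_ax2 p x1 x2 x3 x4 w, prelie3_ax2 p x1 x2 x4 x5 w,
  prelie3_ax2 p x1 x2 x5 x3 w) => ax2E.
rewrite !ax2E (skew x1 x3) (skew x1 x4) (skew x1 x5) !(linearD, linearN) /=.
by ring.
Qed.

Definition semidirect : lie3 (A * dual)%type :=
  Lie3 semidirect_trilinear semidirect_skew semidirect_fundamental.

End SemiDirect.

Section InvariantForm.
Variables (K : fieldType) (A : vectType K).

Definition invariant_form (p : prelie3 A) (B : {symmetric A}) :=
  forall x y z w, B (p x y z) w = - B z (p x y w).

Definition Bsharp (B : {symmetric A}) : 'Hom(A, 'Hom(A, K^o)) :=
  linfun (fun x : A => linfun (B x : A -> K^o)).

Lemma BsharpE (B : {symmetric A}) x y : Bsharp B x y = B x y.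
Proof.
have in_lin z : linear (B z : A -> K^o) by move=> c u v; rewrite linearDr linearZr.
have innerE z v : linfun (B z : A -> K^o) v = B z v.
  pose mf := GRing.isLinear.Build K A K^o *:%R (B z : A -> K^o) (in_lin z).
  pose F : {linear A -> K^o} := HB.pack (B z : A -> K^o) mf.
  exact: (lfunE F).
pose g (z : A) : 'Hom(A, K^o) := linfun (B z : A -> K^o).
have g_lin : linear g.
  move=> c u v; apply/lfunP=> w.
  by rewrite add_lfunE scale_lfunE !innerE linearDl linearZl_LR.
pose mg := GRing.isLinear.Build K A 'Hom(A, K^o) *:%R g g_lin.
pose G : {linear A -> 'Hom(A, K^o)} := HB.pack g mg.
by rewrite /Bsharp (lfunE G) innerE.
Qed.

Definition structE (u : A * 'Hom(A, K^o)) : A * 'Hom(A, K^o) := (u.1, - u.2).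

(* [f^-1%VF] is total; it is the inverse of the map [Bsharp B] because that   *)
(* map is bijective when [B] is nondegenerate.                                *)
Definition structJ (B : {symmetric A}) (u : A * 'Hom(A, K^o)) :
    A * 'Hom(A, K^o) :=
  (- ((Bsharp B)^-1)%VF u.2, Bsharp B u.1).

End InvariantForm.

(* Main.v *)
Require Import Defs.
From mathcomp Require Import all_boot all_algebra.
From mathcomp Require Import reals.
From mathcomp Require Import ring.

Import GRing.Theory Num.Theory.
Local Open Scope ring_scope.

(** The bracket of the semidirect product is built from the bracket of [A] and
from terms that contain exactly one covector, so changing the sign of all
covectors is an automorphism: this is the product structure [E], and it is not
plus or minus the identity because [A] and its dual are nonzero and 2 is
invertible.

For the complex structure [J], nondegeneracy turns [Bsharp B] into an
isomorphism from [A] to its dual, and invariance says exactly that it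
intertwines [L(x, y)] with [L^*(x, y)] ([dualL_Bsharp]). Writing covectors as
[Bsharp B a] therefore turns the semidirect product into [A * A] with the
bracket
  [(x, a), (y, b), (z, c)]
    = ([x, y, z]_C, {x, y, c} + {y, z, a} + {z, x, b})
and [J] into [(x, a) |-> (- a, x)], which is multiplication by i on [x + i a].
There both components of the integrability condition for [J] become identities
between signed sums of products {_, _, _}, in which everything cancels once the
signs are moved out of the products and [C] is written as a cyclic sum.

Finally [J] exchanges the two summands on which [E] acts by 1 and -1, hence the
two anticommute. *)

Section Sharp.
Variables (K : fieldType) (A : vectType K) (B : {symmetric A}).

Hypothesis B_nondeg : nondegenerate B.

Lemma lker_Bsharp : lker (Bsharp B) == 0%VS.
Proof.
move: B_nondeg; rewrite /nondegenerate -!subv0 => /subvP rad0.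
apply/subvP => x; rewrite memv_ker => /eqP Bx0; apply: rad0.
by apply/mem_orthovP => y _; rewrite -BsharpE Bx0 zero_lfunE.
Qed.

(** An injective map is onto here because [A] and its dual have the same
dimension. *)
Lemma limg_Bsharp : limg (Bsharp B) = fullv.
Proof.
apply/eqP; rewrite eqEdim subvf /= limg_dim_eq ?(eqP lker_Bsharp) ?capv0 //.
by rewrite !dimvf /dim /= muln1.
Qed.

Lemma BsharpK : cancel (Bsharp B) ((Bsharp B)^-1)%VF.
Proof. exact/lker0_lfunK/lker_Bsharp. Qed.

Lemma Bsharp_invK : cancel ((Bsharp B)^-1)%VF (Bsharp B).
Proof. by move=> a; rewrite limg_lfunVK // limg_Bsharp memvf. Qed.

End Sharp.

Section ProductStructure.
Variables (K : fieldType) (A : vectType K) (p : prelie3 A).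

Lemma structE_perfect_product : (2%:R : K) != 0 -> fullv != 0%VS :> {vspace A} ->
  perfect_product_structure (semidirect p) (@structE K A).
Proof.
move=> two_neq0 A_neq0.
(* This is where the characteristic matters: E fixes 0 + alpha only if
   alpha = - alpha, and negates x + 0 only if x = - x. *)
have opp_fix (V : lmodType K) (v : V) : v = - v -> v = 0.
  move=> /eqP; rewrite -addr_eq0 -mulr2n -scaler_nat scaler_eq0.
  by rewrite (negPf two_neq0) => /eqP.
split.
- by move=> c u v; congr pair; rewrite /= opprD scalerN.
- by move=> [x a]; rewrite /structE /= opprK.
- move=> E1; case/negP: A_neq0; rewrite -subv0; apply/subvP => x _.
  rewrite memv0; apply/eqP; apply: dual_separates => f.
  (* If E is the identity, every covector vanishes, and covectors separate the points of A. *)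
  rewrite linear0 -(lfunE f).
  have [/esym/opp_fix f0] := E1 (0, linfun f).
  by rewrite f0 zero_lfunE.
- move=> EN1; case/negP: A_neq0; rewrite -subv0; apply/subvP => x _.
  by rewrite memv0; have [/opp_fix ->] := EN1 (x, 0).
- move=> u v w; apply: semidirect_eq => [//|z] /=.
  by rewrite !(add_lfunE, opp_lfunE, dualLE) !opprD.
Qed.

End ProductStructure.

Section ComplexStructure.
Variables (K : fieldType) (A : vectType K) (p : prelie3 A) (B : {symmetric A}).
Hypothesis B_nondeg : nondegenerate B.
Hypothesis B_inv : invariant_form p B.

(** The identification of the double [A * A] with the semidirect product; the
structures on the latter are computed through it. *)
Definition sharp_pair (u : A * A) : A * 'Hom(A, K^o) := (u.1, Bsharp B u.2).

Lemma sharp_pair_surj u : exists v, u = sharp_pair v.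
Proof.
exists (u.1, ((Bsharp B)^-1)%VF u.2).
by rewrite /sharp_pair Bsharp_invK //; case: u.
Qed.

Lemma sharp_pairD u v : sharp_pair u + sharp_pair v = sharp_pair (u + v).
Proof. by rewrite /sharp_pair /= linearD. Qed.

Lemma sharp_pairN u : - sharp_pair u = sharp_pair (- u).
Proof. by rewrite /sharp_pair /= linearN. Qed.

(** What invariance is for: the sign in [L^*] cancels the one in the
invariance of [B]. *)
Lemma dualL_Bsharp x y a : dualL p x y (Bsharp B a) = Bsharp B (p x y a).
Proof. by apply/lfunP=> z; rewrite dualLE !BsharpE B_inv. Qed.

Lemma semidirect_sharp_pair u v w :
  semidirect p (sharp_pair u) (sharp_pair v) (sharp_pair w) =
  sharp_pair (cyclic_sum3 p u.1 v.1 w.1,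
              p u.1 v.1 w.2 + p v.1 w.1 u.2 + p w.1 u.1 v.2).
Proof. by rewrite /= /semidirect_br /sharp_pair /= !dualL_Bsharp !linearD. Qed.

Lemma structJ_sharp_pair u :
  structJ B (sharp_pair u) = sharp_pair (- u.2, u.1).
Proof. by rewrite /structJ /sharp_pair /= BsharpK. Qed.

(** On [A * A] no inverse of [Bsharp B] is left. Take u = (x, a), v = (y, b),
w = (z, c) and sort the integrability condition by the number of entries among
a, b, c. In the first component, [a, b, c]_C from - [Ju, Jv, Jw] meets its own
three summands, with the opposite sign, in the J[., ., .] terms; in the second,
so do the brackets like [a, b, z]_C, and {x, y, z}, {y, z, x}, {z, x, y} add up
to the left-hand side. *)
Lemma structJ_complex : complex_structure (semidirect p) (structJ B).
Proof.
have tri := prelie3_trilinear p.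
pose triN := (tri1N tri, tri2N tri, tri3N tri).
split.
- by move=> c u v; congr pair; rewrite /= linearP // opprD scalerN.
- move=> u; have [v ->] := sharp_pair_surj u.
  by rewrite !structJ_sharp_pair sharp_pairN.
- move=> u v w; have [[x a] ->] := sharp_pair_surj u.
  have [[y b] ->] := sharp_pair_surj v; have [[z c] ->] := sharp_pair_surj w.
  rewrite !(semidirect_sharp_pair, structJ_sharp_pair) /=.
  rewrite !(sharp_pairN, sharp_pairD); congr (sharp_pair (_, _)).
  + by rewrite /= /cyclic_sum3 /= !triN ?opprK; vring.
  + by rewrite /= /cyclic_sum3 /= !triN ?opprK; vring.
Qed.

End ComplexStructure.

Theorem proposition7p8 (R : realType) (A : vectType R) (p : prelie3 A)
    (B : {symmetric A})
    (A_neq0 : fullv != 0%VS :> {vspace A})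
    (B_nondeg : nondegenerate B)
    (B_inv : invariant_form p B) :
  perfect_complex_product_structure (semidirect p) (structJ B) (@structE R A).
Proof.
split.
- exact: structJ_complex.
- by apply: structE_perfect_product; rewrite ?pnatr_eq0.
- by move=> u; congr pair; rewrite /= ?(linearN ((Bsharp B)^-1)%VF) ?opprK.
Qed.
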